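(* If $r,s\geq 2$ are integers, then \[ \operatorname{CR}^2(\diamond_r,\diamond_s)\leq 2\left\lfloor \frac{\sqrt{1+8(r-1)(s-1)}-1}{2}\right\rfloor+3(r+s)-1. \]
   Context: The $r$-diamond $\diamond_r$ is the Hasse diagram of the poset $\{x,y_1,\dots,y_r,z\}$ with $x\le y_i\le z$ for all $i$: a 2-uniform pograph with edges $xy_i$ and $y_iz$ (but not $xz$). Given a coloring of the comparable pairs of a poset $Q$, a copy of $H$ in color $i$ is an injection $f:V(H)\to Q$ with $f(x)\le f(y)$ whenever $x\le y$ such that every edge of $H$ is mapped to a pair of color $i$. $\operatorname{CR}^2(G_1,G_2)$ is the least $N$ such that every 2-coloring of the comparable pairs of the $N$-element chain $C_N$ contains a copy of $G_1$ in color 1 or a copy of $G_2$ in color 2. *)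

(* Defs.v *)
From HB Require Import structures.
From mathcomp Require Import all_boot all_order all_algebra.
From mathcomp Require Import reals.

Set Implicit Arguments.
Unset Strict Implicit.
Unset Printing Implicit Defensive.

Local Open Scope order_scope.

(* In a 2-uniform pograph every edge is a pair of distinct comparable vertices,
   so it is recorded once, in increasing order. *)
Record pograph2 (d : Order.disp_t) := Pograph2 {
  vertex : finPOrderType d;
  edge : rel vertex;
  edge_lt : forall x y, edge x y -> x < y
}.

Section Hasse.
Context {d : Order.disp_t} (P : finPOrderType d).

Definition covers : rel P :=
  [rel x y | (x < y) && [forall z : P, ~~ ((x < z) && (z < y))]].

Lemma covers_lt (x y : P) : covers x y -> x < y.
Proof. by case/andP. Qed.

Definition hasse_diagram : pograph2 d := Pograph2 covers_lt.
End Hasse.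

(* The poset {x, y_1, ..., y_r, z} with x <= y_i <= z. *)
Inductive diamond_poset (r : nat) : Type :=
  DiamondBot | DiamondMid of 'I_r | DiamondTop.

Arguments DiamondBot {r}.
Arguments DiamondMid {r}.
Arguments DiamondTop {r}.

Fact diamond_display : Order.disp_t. Proof. exact: Order.Disp. Qed.

Definition diamond_code (r : nat) (p : diamond_poset r) : option (option 'I_r) :=
  match p with
  | DiamondBot => None
  | DiamondTop => Some None
  | DiamondMid i => Some (Some i)
  end.

Definition diamond_decode (r : nat) (o : option (option 'I_r)) : diamond_poset r :=
  match o with
  | None => DiamondBot
  | Some None => DiamondTop
  | Some (Some i) => DiamondMid i
  end.

Lemma diamond_codeK (r : nat) : cancel (@diamond_code r) (@diamond_decode r).
Proof. by case. Qed.

HB.instance Definition _ (r : nat) :=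
  Finite.copy (diamond_poset r) (can_type (@diamond_codeK r)).

Definition diamond_le (r : nat) (p q : diamond_poset r) : bool :=
  match p, q with
  | DiamondBot, _ => true
  | _, DiamondTop => true
  | DiamondMid i, DiamondMid j => i == j
  | _, _ => false
  end.

Lemma diamond_le_refl (r : nat) : reflexive (@diamond_le r).
Proof. by case=> [|i|] /=. Qed.

Lemma diamond_le_anti (r : nat) : antisymmetric (@diamond_le r).
Proof. by case=> [|i|] [|j|] //= /andP[/eqP-> _]. Qed.

Lemma diamond_le_trans (r : nat) : transitive (@diamond_le r).
Proof. by case=> [|i|] [|j|] [|k|] //= /eqP->. Qed.

HB.instance Definition _ (r : nat) :=
  Order.Le_isPOrder.Build diamond_display (diamond_poset r)
    (@diamond_le_refl r) (@diamond_le_anti r) (@diamond_le_trans r).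

Lemma diamond_ltE (r : nat) (p q : diamond_poset r) :
  (p < q) = match p, q with
            | DiamondBot, DiamondMid _ | DiamondBot, DiamondTop
            | DiamondMid _, DiamondTop => true
            | _, _ => false
            end.
Proof.
have -> : (p < q) = (q != p) && diamond_le p q by rewrite Order.POrderTheory.lt_def.
case: p q => [|i|] [|j|] //=; rewrite ?eqxx //=.
by have [->|_] := eqVneq i j; rewrite ?eqxx ?andbF.
Qed.

Definition diamond (r : nat) : pograph2 diamond_display :=
  hasse_diagram (diamond_poset r).

Lemma diamond_edgeE (r : nat) (p q : diamond_poset r) : (0 < r)%N ->
  edge (p := diamond r) p q =
  match p, q with
  | DiamondBot, DiamondMid _ | DiamondMid _, DiamondTop => true
  | _, _ => false
  end.
Proof.
move=> r_gt0; rewrite /edge /= /covers /= diamond_ltE.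
case: p q => [|i|] [|j|] //=.
- by apply/forallP=> -[|k|]; rewrite !diamond_ltE.
- apply/negbTE/forallPn; exists (DiamondMid (Ordinal r_gt0)).
  by rewrite !diamond_ltE.
- by apply/forallP=> -[|k|]; rewrite !diamond_ltE.
Qed.

(* A coloring of the comparable pairs of Q is given by c : Q -> Q -> C, the
   color of the pair x < y being c x y; other values of c are irrelevant. *)
Definition has_copy (d d' : Order.disp_t) (Q : porderType d) (C : Type)
    (c : Q -> Q -> C) (i : C) (H : pograph2 d') : Prop :=
  exists f : vertex H -> Q,
    [/\ injective f,
        forall x y, x <= y -> f x <= f y &
        forall x y, edge x y -> c (f x) (f y) = i].

(* 'I_N is the N-element chain; colors 1 and 2 are true and false. *)
Definition chain_arrows (d1 d2 : Order.disp_t) (G1 : pograph2 d1)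
    (G2 : pograph2 d2) (N : nat) : Prop :=
  forall c : 'I_N -> 'I_N -> bool, has_copy c true G1 \/ has_copy c false G2.

(* N = CR^2(G1, G2). *)
Definition is_chain_ramsey (d1 d2 : Order.disp_t) (G1 : pograph2 d1)
    (G2 : pograph2 d2) (N : nat) : Prop :=
  chain_arrows G1 G2 N /\ forall M, chain_arrows G1 G2 M -> (N <= M)%N.

(* Main.v *)
Require Import Defs.
From mathcomp Require Import all_boot all_order all_algebra.
From mathcomp Require Import boolp reals.
From mathcomp Require Import zify lra.

Import Order.TTheory GRing.Theory Num.Theory.

Local Open Scope ring_scope.

(** Put [a = r - 1], [b = s - 1] and suppose that there is no copy.  At most
    [a + b] vertices are joined to the least element [x] and to the greatest
    element [z] by the same color; the others form two classes according to their
    color towards [x].  Inside the class with color 1 towards [x] and color 2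
    towards [z], every vertex [v] has at most [a] predecessors in color 1 (they
    lie in the middle of a diamond from [x] to [v]) and at most [b] successors in
    color 2.  So in a class with [n = a + b + 1 + t] elements there are at most
    [\sum_(i < n) minn i a] pairs of color 1 and [\sum_(i < n) minn i b] of color
    2; comparing with the total [n (n - 1) / 2] gives [t (t + 1) <= 2 a b].  The
    other class is symmetric. *)

(** The first [a] terms are 0, ..., a - 1 and the other [k] equal [a]; doubling and moving [a] to
    the left avoids division and subtraction. *)
Lemma sum_minn (a k : nat) :
  (2 * \sum_(i < a + k) minn i a + a = a * a + 2 * a * k)%N.
Proof.
elim: k => [|k IHk]; last first.
  rewrite addnS big_ord_recr /= mulnDr addnAC IHk (minn_idPr (leq_addr k a)).
  by rewrite mulnS; lia.
have base n : (n <= a -> 2 * \sum_(i < n) minn i a + n = n * n)%N.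
  elim: n => [|n IHn] lt_na; first by rewrite big_ord0.
  rewrite big_ord_recr /= mulnDr (minn_idPl (ltnW lt_na)).
  by have := IHn (ltnW lt_na); rewrite mulnS mulSn; lia.
by rewrite addn0 muln0 addn0 base.
Qed.

Lemma pairs_degree_bound (n a b t : nat) (c : rel 'I_n) :
    n = (a + b + 1 + t)%N ->
    (forall j : 'I_n, #|[set i : 'I_n | (i < j)%N && c i j]| <= a)%N ->
    (forall i : 'I_n, #|[set j : 'I_n | (i < j)%N && ~~ c i j]| <= b)%N ->
  (t * t.+1 <= 2 * (a * b))%N.
Proof.
move=> n_eq in_le out_le.
have card_lt (j : 'I_n) : #|[set i : 'I_n | (i < j)%N]| = j.
  by rewrite cardsE -sum1_card (big_ord_narrow (ltnW (ltn_ord j))) sum1_card card_ord.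
have card_gt (i : 'I_n) : #|[set j : 'I_n | (i < j)%N]| = rev_ord i.
  rewrite -(card_lt (rev_ord i)) -(card_imset _ rev_ord_inj).
  apply: eq_card => j; rewrite inE; apply/imsetP/idP => [[k]|lt_j].
    by rewrite inE => ? ->/=; have := ltn_ord k; lia.
  exists (rev_ord j); rewrite ?rev_ordK // inE.
  by move: lt_j => /=; have := ltn_ord i; have := ltn_ord j; lia.
have in_sum : (\sum_(j < n) #|[set i : 'I_n | (i < j)%N && c i j]|
    <= \sum_(j < n) minn j a)%N.
  apply: leq_sum => j _; rewrite leq_min in_le andbT -[X in (_ <= X)%N]card_lt.
  by apply: subset_leq_card; apply/subsetP=> i; rewrite !inE => /andP[].
have out_sum : (\sum_(i < n) #|[set j : 'I_n | (i < j)%N && ~~ c i j]|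
    <= \sum_(j < n) minn j b)%N.
  (* Vertex [i] has only n - 1 - i successors, so the sum is read backwards. *)
  rewrite [X in (_ <= X)%N](reindex_inj rev_ord_inj).
  apply: leq_sum => i _; rewrite leq_min out_le andbT -[X in (_ <= X)%N]card_gt.
  by apply: subset_leq_card; apply/subsetP=> j; rewrite !inE => /andP[].
(* Each pair is counted once, by its upper end in one color or its lower end in the other. Writing j
   as [minn j n] lets [sum_minn] evaluate the total. *)
have total : (\sum_(j < n) #|[set i : 'I_n | (i < j)%N && c i j]| +
    \sum_(i < n) #|[set j : 'I_n | (i < j)%N && ~~ c i j]| = \sum_(j < n) minn j n)%N.
  under eq_bigr do rewrite -sum1_card.
  under [X in (_ + X)%N]eq_bigr do rewrite -sum1_card.
  under [X in (_ + X)%N]eq_bigr do rewrite big_mkcond.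
  rewrite [X in (_ + X)%N]exchange_big -big_split /=.
  apply: eq_bigr => j _; rewrite (minn_idPl (ltnW (ltn_ord j))) -[RHS]card_lt.
  rewrite -big_mkcond -[RHS]sum1_card [RHS](bigID (fun i => c i j)) /=.
  by congr (_ + _)%N; apply: eq_bigl => i; rewrite !inE.
(* For this [n], the doubled total minus the doubled bounds is exactly t(t + 1) - 2ab. *)
have := sum_minn a (b + 1 + t); have := sum_minn b (a + 1 + t).
have := sum_minn n 0; rewrite addn0 muln0.
have -> : (a + (b + 1 + t) = n)%N by lia.
have -> : (b + (a + 1 + t) = n)%N by lia.
have := leq_add in_sum out_sum; rewrite total n_eq; nia.
Qed.

(** The enumeration of a set of ordinals filters an increasing list. This lets a class be relabelled
    as a chain. *)
Lemma enum_val_ltn (N : nat) (A : {set 'I_N}) (i j : 'I_#|A|) :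
  (i < j)%N -> (enum_val i < enum_val j)%N.
Proof.
move=> lt_ij; rewrite /enum_val.
have x0 := enum_val i.
rewrite !(set_nth_default x0) -?cardE //.
have srt : sorted (relpre val ltn) (enum A).
  rewrite /enum_mem -enumT; apply: sorted_filter; first by move=> ? ? ?; apply: ltn_trans.
  by rewrite -sorted_map val_enum_ord iota_ltn_sorted.
apply: (sorted_ltn_nth _ x0 srt) => //; first by move=> ? ? ?; apply: ltn_trans.
all: by rewrite inE -cardE.
Qed.

Section Diamonds.
Context {N : nat} (c : 'I_N -> 'I_N -> bool).

Definition diamond_mids (col : bool) (x z : 'I_N) : {set 'I_N} :=
  [set y : 'I_N | [&& (x < y)%N, (y < z)%N, c x y == col & c y z == col]].

Lemma diamond_copy (col : bool) (r : nat) (x z : 'I_N) :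
  (0 < r)%N -> (r <= #|diamond_mids col x z|)%N -> has_copy c col (diamond r).
Proof.
move=> r_gt0 le_r; pose g i := enum_val (widen_ord le_r i).
have gP i : [&& (x < g i)%N, (g i < z)%N, c x (g i) == col & c (g i) z == col].
  by have := enum_valP (widen_ord le_r i); rewrite inE.
have g_inj : injective g.
  by move=> i j /enum_val_inj /(congr1 val) /= ?; apply: val_inj.
(* Since [r] is positive, some middle vertex lies between [x] and [z]. *)
have lt_xz : (x < z)%N.
  by case/and4P: (gP (Ordinal r_gt0)) => /ltn_trans lt /lt.
exists (fun p : diamond_poset r =>
  match p with DiamondBot => x | DiamondMid i => g i | DiamondTop => z end).
split.
- by move=> [|i|] [|j|] //; try (by move=> /g_inj->);
    move=> /(congr1 val) /=; try case/and4P: (gP i); try case/and4P: (gP j); lia.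
- move=> [|i|] [|j|] //; rewrite leEord /=; try (by move=> /eqP->);
    move=> _; try case/and4P: (gP i); try case/and4P: (gP j); lia.
move=> [|i|] [|j|]; rewrite diamond_edgeE // => _.
  by case/and4P: (gP j) => _ _ /eqP.
by case/and4P: (gP i) => _ _ _ /eqP.
Qed.

Definition split_class (col : bool) (x z : 'I_N) : {set 'I_N} :=
  [set y : 'I_N | [&& (x < y)%N, (y < z)%N, c x y == col & c y z == ~~ col]].

Lemma card_split_class (col : bool) (a b t : nat) (x z : 'I_N) :
    (forall u v, #|diamond_mids col u v| <= a)%N ->
    (forall u v, #|diamond_mids (~~ col) u v| <= b)%N ->
    #|split_class col x z| = (a + b + 1 + t)%N ->
  (t * t.+1 <= 2 * (a * b))%N.
Proof.
set A := split_class col x z => mids_a mids_b cardA.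
pose g (i : 'I_#|A|) : 'I_N := enum_val i.
have gP i : [&& (x < g i)%N, (g i < z)%N, c x (g i) == col & c (g i) z == ~~ col].
  by have := enum_valP i; rewrite inE.
have g_lt (i j : 'I_#|A|) : (i < j)%N -> (g i < g j)%N by move=> ?; apply: enum_val_ltn.
have g_inj : injective g by exact: enum_val_inj.
apply: (@pairs_degree_bound _ a b t
  (fun i j : 'I_#|A| => c (g i) (g j) == col)) => [//|i|i].
  apply: leq_trans (mids_a x (g i)); rewrite -(card_imset _ g_inj).
  apply: subset_leq_card; apply/subsetP=> _ /imsetP[j + ->].
  rewrite !inE => /andP[lt_ji cji].
  by case/and4P: (gP j) => -> _ -> _; rewrite g_lt.
apply: leq_trans (mids_b (g i) z); rewrite -(card_imset _ g_inj).
apply: subset_leq_card; apply/subsetP=> _ /imsetP[j + ->].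
rewrite !inE => /andP[lt_ij cij].
case/and4P: (gP j) => _ -> _ ->; rewrite g_lt //=.
by case: (c _ _) cij; case: (col).
Qed.

End Diamonds.

(** Without a copy there are at most 2 + (a + b) + 2(a + b + 1 + m) vertices: the ends, the middles
    in either color and the two classes. This is one less than the stated length. *)
Lemma chain_arrows_diamond (a b m : nat) :
    (forall t, t * t.+1 <= 2 * (a * b) -> t <= m)%N ->
  chain_arrows (diamond a.+1) (diamond b.+1) (2 * m + 3 * (a + b) + 5).
Proof.
move=> m_max; rewrite addnS addnS; move n_eq: (2 * m + 3 * (a + b) + 3)%N => n c.
have [/existsP[x /existsP[z le_r]]|no1] :=
    boolP [exists x, exists z, a < #|diamond_mids c true x z|]%N.
  by left; apply: diamond_copy le_r.
have [/existsP[x /existsP[z le_s]]|no2] :=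
    boolP [exists x, exists z, b < #|diamond_mids c false x z|]%N.
  by right; apply: diamond_copy le_s.
have mids1 u v : (#|diamond_mids c true u v| <= a)%N.
  by move/existsPn/(_ u)/existsPn/(_ v): no1; rewrite -leqNgt.
have mids2 u v : (#|diamond_mids c false u v| <= b)%N.
  by move/existsPn/(_ u)/existsPn/(_ v): no2; rewrite -leqNgt.
exfalso.
pose x : 'I_n.+2 := ord0; pose z : 'I_n.+2 := ord_max.
have split1 : (#|split_class c true x z| <= a + b + 1 + m)%N.
  have [|lt_n] := leqP #|split_class c true x z| (a + b + 1); first by lia.
  rewrite -(subnKC (ltnW lt_n)) leq_add2l; apply: m_max.
  by apply: (@card_split_class _ c true a b _ x z) => //; rewrite subnKC // ltnW.
have split2 : (#|split_class c false x z| <= a + b + 1 + m)%N.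
  have [|lt_n] := leqP #|split_class c false x z| (a + b + 1); first by lia.
  (* In the second class the colors, hence [a] and [b], trade places. *)
  rewrite -(subnKC (ltnW lt_n)) leq_add2l; apply: m_max; rewrite (mulnC a).
  apply: (@card_split_class _ c false b a _ x z) => //.
  by rewrite (addnC b) subnKC // ltnW.
have cover : [set: 'I_n.+2] \subset [set x; z] :|:
    (diamond_mids c true x z :|: diamond_mids c false x z) :|:
    (split_class c true x z :|: split_class c false x z).
  apply/subsetP=> y _; rewrite !inE -!val_eqE /=.
  have := ltn_ord y; case: (c x y); case: (c y z) => /=; lia.
have cardU (A B : {set 'I_n.+2}) p q :
    (#|A| <= p -> #|B| <= q -> #|A :|: B| <= p + q)%N.
  by move=> Ap Bq; apply: leq_trans (leq_add Ap Bq); rewrite leq_card_setU.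
have ends : (#|[set x; z]| <= 2)%N by rewrite cards2; case: (x != z).
have := leq_trans (subset_leq_card cover)
  (cardU _ _ _ _ (cardU _ _ _ _ ends (cardU _ _ _ _ (mids1 x z) (mids2 x z)))
    (cardU _ _ _ _ split1 split2)).
by rewrite cardsT card_ord; lia.
Qed.

Lemma chain_ramsey_exists (d1 d2 : Order.disp_t) (G1 : pograph2 d1)
    (G2 : pograph2 d2) (K : nat) :
  chain_arrows G1 G2 K -> exists2 N, is_chain_ramsey G1 G2 N & (N <= K)%N.
Proof.
move=> arrK.
have ex : exists N, `[< chain_arrows G1 G2 N >] by exists K; apply/asboolP.
case: (ex_minnP ex) => N /asboolP arrN minN.
exists N; last by apply/minN/asboolP.
by split=> // M arrM; apply/minN/asboolP.
Qed.

(** The hypothesis is equivalent to (2t + 1)^2 <= 1 + 8k. *)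
Lemma floor_root_ge (R : realType) (k t : nat) :
  (t * t.+1 <= 2 * k)%N ->
  t%:Z <= Num.floor ((Num.sqrt (1 + 8 * k%:R) - 1) / 2 : R).
Proof.
rewrite -(ler_nat R) !natrM -natr1 => le_t.
rewrite floor_ge_int ler_pdivlMr // lerBrDr -pmulrn.
have -> : t%:R * 2 + 1 = Num.sqrt ((t%:R * 2 + 1) ^+ 2) :> R.
  by rewrite sqrtr_sqr ger0_norm // addr_ge0 // mulr_ge0.
rewrite ler_sqrt; last by rewrite addr_ge0 // mulr_ge0.
nra.
Qed.

Theorem theorem3p8 (R : realType) (r s : nat) (hr : (2 <= r)%N) (hs : (2 <= s)%N) :
  exists N : nat,
    is_chain_ramsey (diamond r) (diamond s) N /\
    (N%:Z <= 2 * Num.floor ((Num.sqrt (1 + 8 * (r%:R - 1) * (s%:R - 1)) - 1) / 2 : R)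
             + 3 * (r%:Z + s%:Z) - 1).
Proof.
case: r s hr hs => [//|a] [//|b] _ _.
rewrite -(natr1 a) -(natr1 b) !addrK -mulrA -natrM.
set f := Num.floor _.
have f_max t : (t * t.+1 <= 2 * (a * b))%N -> t%:Z <= f by apply: floor_root_ge.
(* The case t = 0 shows that [f] equals its absolute value, a natural number usable as [m]. *)
have f_ge0 : 0 <= f by apply: (f_max 0%N).
have arr : chain_arrows (diamond a.+1) (diamond b.+1) (2 * `|f| + 3 * (a + b) + 5).
  by apply: chain_arrows_diamond => t /f_max; lia.
have [N ramseyN leN] := chain_ramsey_exists _ _ _ _ _ arr.
by exists N; split=> //; lia.
Qed.
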